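(* Let $\beta\ge 1/3$ be a fixed real number. For each positive integer $k$ put $\alpha=\beta k^2$, and let $P=P_k\subset\mathbb{R}^2$ be the convex pentagon with vertices $$(-1,-\alpha-2k),\quad (-1,\alpha+4),\quad (0,\alpha+4),\quad (1,\alpha),\quad (1,-\alpha).$$ For $t>0$ let $u_t(x,y)=\max(y-\alpha+kt,\,0)$, and let $\mathcal{L}=\mathcal{L}_{P_k}$ be the functional defined in the context. Then $P$ is not destabilized by any $u_t$ for $k$ large enough and $0<t\ll k$. That is, there exist $K\in\mathbb{N}$ and $c>0$ (depending only on $\beta$) such that for all integers $k\ge K$ and all real $t$ with $0<t\le ck$, $$\mathcal{L}_{P_k}(u_t)\ge 0.$$
   Context: Let $\Delta\subset\mathbb{R}^2$ be a convex polygon whose edges have rational directions. The measure $d\sigma$ on the boundary $\partial\Delta$ is defined edge by edge: if an edge $F$ has direction line $\vec F$ with $\mathbb{Z}^2\cap\vec F=\mathbb{Z}v$, then $d\sigma|_F$ is the translate of the Lebesgue measure on $\vec F$ normalized so that the segment $[0,v]$ has mass $1$. The linear functional $\mathcal{L}=\mathcal{L}_\Delta:C^0(\Delta,\mathbb{R})\to\mathbb{R}$ is $$\mathcal{L}(f)=\int_{\partial\Delta}f\,d\sigma-\int_\Delta(a_0+a_1x+a_2y)\,f(x,y)\,dx\,dy,$$ where $a_0,a_1,a_2$ are the unique real numbers such that $\mathcal{L}$ vanishes on the constant function $1$ and on the coordinate functions $x$ and $y$. A convex function $f:\Delta\to\mathbb{R}$ destabilizes $\Delta$ if $\mathcal{L}(f)<0$;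 $\Delta$ is relatively K-unstable if such an $f$ exists. *)

(* Defs.v *)
From HB Require Import structures.
From mathcomp Require Import all_boot all_order all_algebra.
From mathcomp Require Import all_classical all_reals all_analysis.
From mathcomp Require Import measurable_realfun.

Set Implicit Arguments.
Unset Strict Implicit.
Unset Printing Implicit Defensive.

Import Order.TTheory GRing.Theory Num.Theory.
Import numFieldNormedType.Exports.

Local Open Scope classical_set_scope.
Local Open Scope ring_scope.

Section polygon.
Context {R : realType}.
Implicit Types (p q w : R * R) (vs : seq (R * R)) (f : R * R -> R).

Definition convex_hull (A : set (R * R)) : set (R * R) :=
  smallest (@convex_set R (R * R)%type) A.

Definition lattice_point (z : int * int) : R * R := (z.1%:~R, z.2%:~R).

(* Z^2 meets the line R w exactly in Z v *)
Definition lattice_generator w (v : int * int) : Prop :=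
  [set z | exists c : R, lattice_point z = c *: w] =
  [set z | exists m : int, z = v *~ m].

(* One of the two generators +-v, when w has a rational direction; the choice
   of sign does not affect the measure below. *)
Definition edge_generator w : int * int := xget 0 (lattice_generator w).

Definition line_param p w (s : R) : R * R :=
  p + s *: lattice_point (edge_generator w).

Lemma measurable_line_param p w : measurable_fun [set: R] (line_param p w).
Proof.
apply: measurable_fun_pair; apply: measurable_funD => //;
  exact: measurable_funM.
Qed.

(* Lebesgue measure on the line p + R w, normalized so that the segment from p
   to p + v has mass 1, v being the generator of Z^2 on R w. *)
Definition line_measure p w : set (R * R) -> \bar R :=
  pushforward (@lebesgue_measure R) (line_param p w).

Let line_measure0 p w : line_measure p w set0 = 0%E.
Proof. by rewrite /line_measure /pushforward preimage_set0 measure0. Qed.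

Let line_measure_ge0 p w A : (0 <= line_measure p w A)%E.
Proof. exact: (measure_ge0 (@lebesgue_measure R)). Qed.

Let line_measure_sigma_additive p w : semi_sigma_additive (line_measure p w).
Proof.
have mlp := measurable_line_param p w.
rewrite -[line_measure p w]/(pushforward lebesgue_measure (line_param p w)).
exact: measure_semi_sigma_additive.
Qed.

HB.instance Definition _ p w := isMeasure.Build _ _ _ (line_measure p w)
  (line_measure0 p w) (line_measure_ge0 p w)
  (@line_measure_sigma_additive p w).

(* A convex polygon is given by the list vs of its vertices, in cyclic order
   along the boundary (either orientation). *)
Definition polygon vs : set (R * R) := convex_hull [set` vs].

Definition edges vs : seq ((R * R) * (R * R)) := zip vs (rot 1 vs).

Definition boundary_integral vs f : R :=
  \sum_(e <- edges vs)
    \int[line_measure e.1 (e.2 - e.1)]_(z in convex_hull [set e.1; e.2]) f z.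

Definition functional_with vs (a : R * R * R) f : R :=
  boundary_integral vs f -
  \int[(lebesgue_measure \x lebesgue_measure)%E]_(z in polygon vs)
     ((a.1.1 + a.1.2 * z.1 + a.2 * z.2) * f z).

Definition vanishes_on_affine vs (a : R * R * R) : Prop :=
  [/\ functional_with vs a (fun=> 1) = 0,
      functional_with vs a (fun z => z.1) = 0
    & functional_with vs a (fun z => z.2) = 0].

(* For a nondegenerate polygon exactly one triple (a0, a1, a2) makes the
   functional vanish on affine functions; xget selects it. *)
Definition relK_functional vs f : R :=
  functional_with vs (xget 0 (vanishes_on_affine vs)) f.

End polygon.

Definition pentagon (R : realType) (beta : R) (k : nat) : seq (R * R) :=
  let alpha := beta * k%:R ^+ 2 in
  [:: (-1, - alpha - 2 * k%:R); (-1, alpha + 4); (0, alpha + 4);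
      (1, alpha); (1, - alpha)].

Definition crease (R : realType) (beta : R) (k : nat) (t : R) (z : R * R) : R :=
  let alpha := beta * k%:R ^+ 2 in
  Num.max (z.2 - alpha + k%:R * t) 0.

(* Main.v *)
Require Import Defs.
From mathcomp Require Import all_boot all_order all_algebra.
From mathcomp Require Import all_classical all_reals all_analysis.
From mathcomp Require Import measurable_realfun ring lra.

(** Write [al] for [beta * k ^ 2] and [h] for [k * t], so that the crease is
    [max (y - al + h) 0]. The value of the functional at the crease is the
    boundary integral [h ^ 2 + 6 * h + 14] minus an area integral whose leading
    part cancels it, because the weight [a0 + a1 * x + a2 * y] is close to 1.
    Solving for the weight to the relevant order in [1 / k] shows that what
    remains is, up to relative errors [O (1 / k)] in the coefficients,

      [10 / 3 - 4 * t / (3 * beta) + (1 / beta + 1 / (6 * beta ^ 2)) * t ^ 2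
        - t ^ 3 / (2 * beta ^ 2 * k)].

    The quadratic part, times [6 * beta ^ 2], is
    [20 * beta ^ 2 - 8 * beta * t + (6 * beta + 1) * t ^ 2], which has negative
    discriminant, and for [t <= beta * k / 4] the cubic term takes away only a
    fraction of the [t ^ 2] term. So the functional is nonnegative once [k] is
    large.

    The proof makes this exact rather than asymptotic. If the conditions on
    [(a0, a1, a2)] have a solution, they are a linear system in the moments of
    the pentagon, and Cramer's rule writes the value at the crease as a
    polynomial in [beta], [k], [h] divided by the positive determinant of the
    moment matrix ([crease_value_scaled]). For [beta >= 1 / 3] and [k >= 10]
    the lower order monomials of its coefficients are absorbed by the leading
    ones, and the polynomial is at least a positive multiple of the square of
    [k - h] ([margin_ge0]). If the conditions have no solution, the selected
    triple is zero and the functional is the boundary integral alone.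

    The moments are computed as follows. The pentagon is the region between
    two graphs ([pentagonE]); Fubini ([region_integral]) reduces area integrals
    to one variable, and a Bezout certificate for the primitive direction of an
    edge reduces boundary integrals to one variable as well
    ([edge_integral]). All integrands are piecewise cubic, where Simpson's rule
    is exact ([Rintegral_piecewise]). *)

Set Implicit Arguments.
Unset Strict Implicit.
Unset Printing Implicit Defensive.
Import Order.TTheory GRing.Theory Num.Theory.
Import numFieldNormedType.Exports.
Local Open Scope classical_set_scope.
Local Open Scope ring_scope.

(** * Integration of piecewise cubic functions *)

Section one_variable.
Context {R : realType}.
Local Notation mu := (@lebesgue_measure R).
Implicit Types (f : R -> R) (a b c : R).

(** Simpson's rule is exact on cubics.  Every integral below reduces to cubic
    pieces, so that the moments of the pentagon are finite combinations of
    point values, which field identities evaluate. *)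
Definition simpson f a b : R :=
  (b - a) / 6 * (f a + 4 * f ((a + b) / 2) + f b).

Lemma integrable_segment f a b :
  continuous f -> mu.-integrable `[a, b] (EFin \o f).
Proof.
move=> cf; apply: continuous_compact_integrable; first exact: segment_compact.
exact: continuous_subspaceT.
Qed.

Lemma Rintegral_point f a : \int[mu]_(x in `[a, a]) f x = 0.
Proof. by rewrite set_itv1 Rintegral_set1. Qed.

Lemma Rintegral_chasles f a b c : continuous f -> a <= c -> c <= b ->
  \int[mu]_(x in `[a, b]) f x =
  \int[mu]_(x in `[a, c]) f x + \int[mu]_(x in `[c, b]) f x.
Proof.
move=> cf ac cb.
have intf := integrable_segment a b cf.
have := @Rintegral_itvB R f (BLeft a) (BRight b) c intf.
rewrite !bnd_simp => /(_ ac cb) E.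
rewrite -(@Rintegral_itv_obnd_cbnd _ c) -?E; first by rewrite addrC subrK.
apply: integrableS (intf) => //.
by apply: subset_itvr; rewrite bnd_simp.
Qed.

Lemma Rintegral_FTC f F a b : a <= b -> continuous f ->
  (forall x, is_derive x (1 : R) F (f x)) ->
  \int[mu]_(x in `[a, b]) f x = F b - F a.
Proof.
rewrite le_eqVlt => /predU1P[->|ab] cf dF; first
  by rewrite Rintegral_point subrr.
have cF : continuous F.
  move=> x; apply: differentiable_continuous; apply/derivable1_diffP.
  exact: (@ex_derive _ _ _ _ _ _ _ (dF x)).
rewrite /Rintegral (@continuous_FTC2 _ f F)//.
- exact: continuous_subspaceT.
- split.
  + move=> x _; exact: (@ex_derive _ _ _ _ _ _ _ (dF x)).
  + exact: cvg_at_right_filter (cF a).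
  + exact: cvg_at_left_filter (cF b).
- move=> x _; rewrite derive1E; exact: (@derive_val _ _ _ _ _ _ _ (dF x)).
Qed.

Definition cubic f : Prop := exists c0 c1 c2 c3 : R,
  forall x, f x = c0 + c1 * x + c2 * x ^+ 2 + c3 * x ^+ 3.

Lemma cubic_horner f : cubic f -> exists P : {poly R},
  (forall x, f x = P^`().[x]) /\
  forall a b, simpson f a b = P.[b] - P.[a].
Proof.
case=> c0 [c1 [c2 [c3 fE]]].
exists (c0 *: 'X + (c1 / 2) *: 'X^2 + (c2 / 3) *: 'X^3 + (c3 / 4) *: 'X^4).
split=> [x|a b]; first by rewrite fE !poly.derivE !hornerE /=; field.
by rewrite /simpson !fE !hornerE /=; field.
Qed.

Lemma cubic_continuous f : cubic f -> continuous f.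
Proof.
move=> /cubic_horner[P [fE _]]; have -> : f = horner P^`() by apply/funext.
exact: continuous_horner.
Qed.

Lemma Rintegral_cubic f a b : a <= b -> cubic f ->
  \int[mu]_(x in `[a, b]) f x = simpson f a b.
Proof.
move=> ab cf; have [P [fE ->]] := cubic_horner cf.
apply: (Rintegral_FTC ab (cubic_continuous cf)) => x.
by rewrite fE; exact: is_derive_poly.
Qed.

Lemma Rintegral_simpson f g a b : a <= b -> cubic g ->
  (forall x, a <= x -> x <= b -> f x = g x) ->
  \int[mu]_(x in `[a, b]) f x = simpson g a b.
Proof.
move=> ab cg fg; rewrite -(Rintegral_cubic ab cg).
by apply: eq_Rintegral => x; rewrite inE/= in_itv/= => /andP[ax xb]; exact: fg.
Qed.

(** The two cubics agree at [c], so the integrand coincides on [[a, b]] with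
    the globally continuous function [g1 (min x c) + g2 (max x c) - g1 c],
    whose integral can be cut at [c]. *)
Lemma Rintegral_piecewise f g1 g2 a c b : a <= c -> c <= b ->
  cubic g1 -> cubic g2 ->
  (forall x, a <= x -> x <= c -> f x = g1 x) ->
  (forall x, c <= x -> x <= b -> f x = g2 x) ->
  \int[mu]_(x in `[a, b]) f x = simpson g1 a c + simpson g2 c b.
Proof.
move=> ac cb c1 c2 fg1 fg2.
pose g x := g1 (Num.min x c) + g2 (Num.max x c) - g1 c.
have g12 : g1 c = g2 c by rewrite -fg1// fg2.
have gl x : x <= c -> g x = g1 x.
  by move=> xc; rewrite /g min_l// max_r// -g12 addrK.
have gr x : c <= x -> g x = g2 x.
  by move=> cx; rewrite /g min_r// max_l// addrC addKr.
have cg : continuous g.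
  move=> x; apply: cvgB; last exact: cvg_cst.
  apply: cvgD.
    apply: (@continuous_comp _ _ _ (fun x => Num.min x c) g1).
      apply: (@continuous_min _ _ id (cst c)); first exact: cvg_id.
      exact: cvg_cst.
    exact: cubic_continuous.
  apply: (@continuous_comp _ _ _ (fun x => Num.max x c) g2).
    apply: (@continuous_max _ _ id (cst c)); first exact: cvg_id.
    exact: cvg_cst.
  exact: cubic_continuous.
transitivity (\int[mu]_(x in `[a, b]) g x).
  apply: eq_Rintegral => x; rewrite inE/= in_itv/= => /andP[ax xb].
  have [xc|/ltW cx] := leP x c; first by rewrite gl// fg1.
  by rewrite gr// fg2.
rewrite (Rintegral_chasles cg ac cb); congr (_ + _).
- by apply: Rintegral_simpson => // x _ /gl.
- by apply: Rintegral_simpson => // x /gr.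
Qed.
End one_variable.

(** * Convex hulls in the plane and generators of lattice lines *)

Section convexity.
Context {R : realType}.
Implicit Types (p q z : R * R) (A : set (R * R)) (s : R).

Lemma plane_eq p q : p.1 = q.1 -> p.2 = q.2 -> p = q.
Proof. by case: p q => [? ?] [? ?] /= -> ->. Qed.

Lemma scale_planeE (s : R) p : s *: p = (s * p.1, s * p.2).
Proof. by []. Qed.

Lemma convex_setP A :
  (forall p q s, 0 <= s -> s <= 1 -> A p -> A q -> A (s *: p + (1 - s) *: q)) ->
  @convex_set R (R * R)%type A.
Proof.
move=> cA p q l; rewrite !inE => Ap Aq.
by apply: cA.
Qed.

Lemma convex_hull_mem A p : A p -> convex_hull A p.
Proof. by move=> Ap; exact: sub_gen_smallest. Qed.

Lemma convex_hull_conv A p q z s : convex_hull A p -> convex_hull A q ->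
  0 <= s -> s <= 1 -> z = s *: p + (1 - s) *: q -> convex_hull A z.
Proof.
move=> hp hq s0 s1 -> B [cB AB].
have := cB p q (Itv01 s0 s1).
by rewrite !inE; apply; [exact: hp | exact: hq].
Qed.

Lemma convex_hull_sub A B : A `<=` B ->
  (forall p q s, 0 <= s -> s <= 1 -> B p -> B q -> B (s *: p + (1 - s) *: q)) ->
  convex_hull A `<=` B.
Proof. by move=> AB cB; apply: smallest_sub => //; exact: convex_setP. Qed.

Lemma convex_hull2E p q :
  convex_hull [set p; q] =
  [set z | exists2 s : R, 0 <= s <= 1 & z = p + s *: (q - p)].
Proof.
apply/seteqP; split; last first.
  move=> z [s /andP[s0 s1] ->].
  apply: (@convex_hull_conv _ q p _ s) => //.
  - by apply: convex_hull_mem; right.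
  - by apply: convex_hull_mem; left.
  - by apply: plane_eq; rewrite !scale_planeE/=; ring.
apply: convex_hull_sub.
  move=> z [->|->].
  - by exists 0; rewrite ?lexx ?ler01// scale0r addr0.
  - by exists 1; rewrite ?lexx ?ler01// scale1r addrC subrK.
move=> _ _ s s0 s1 [a /andP[a0 a1] ->] [b /andP[b0 b1] ->].
exists (s * a + (1 - s) * b); first by apply/andP; split; nra.
by apply: plane_eq; rewrite !scale_planeE/=; ring.
Qed.

End convexity.

Section lattice.
Context {R : realType}.
Implicit Types (v : int * int) (w : R * R).

Lemma mulrz_pairE v (m : int) : v *~ m = (v.1 * m, v.2 * m).
Proof.
suff E n : v *+ n = (v.1 *+ n, v.2 *+ n).
  by rewrite -!mulrzz; case: m => n; rewrite /intmul E.
by elim: n => [|n IH]; rewrite ?mulr0n// !mulrS IH.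
Qed.

(** A Bezout relation is a convenient certificate of primitivity: pairing a
    lattice point [t *: v] with [u] gives [t], so [t] is an integer. *)
Lemma lattice_generator_bezout w v (u : int * int) (c : R) :
  c != 0 -> w = c *: lattice_point v -> u.1 * v.1 + u.2 * v.2 = 1 ->
  lattice_generator w v.
Proof.
move=> c0 -> uv; apply/seteqP; split=> z /=; last first.
  case=> m ->; exists (m%:~R / c); rewrite scalerA divfK//.
  by rewrite mulrz_pairE /lattice_point !intrM scale_planeE/= !(mulrC m%:~R).
case=> d; rewrite scalerA scale_planeE => -[z1 z2].
exists (u.1 * z.1 + u.2 * z.2).
have uvR : u.1%:~R * v.1%:~R + u.2%:~R * v.2%:~R = 1 :> R.
  by rewrite -!intrM -intrD uv.
have dE : d * c = (u.1 * z.1 + u.2 * z.2)%:~R.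
  by rewrite intrD !intrM z1 z2 -[LHS]mulr1 -[X in _ * X = _]uvR /=; ring.
rewrite mulrz_pairE [LHS]surjective_pairing; apply/pair_equal_spec; split.
- by apply: (@intr_inj R); rewrite z1 dE mulrC -intrM.
- by apply: (@intr_inj R); rewrite z2 dE mulrC -intrM.
Qed.

(** Two generators are integer multiples of each other, by factors whose
    product is 1. *)
Lemma lattice_generator_opp w v v' : lattice_generator w v ->
  lattice_generator w v' -> v != 0 -> v' = v \/ v' = - v.
Proof.
rewrite /lattice_generator => -> /seteqP[s1 s2] v0.
have [|m vE] := s1 v; first by exists 1.
have [|m' vE'] := s2 v'; first by exists 1.
have m'1 : m' * m = 1.
  have : v = v *~ (m' * m) by rewrite mulrzA -vE' -vE.
  move: v0; rewrite mulrz_pairE; case: v {s1 s2 vE vE'} => a b v0 [aE bE].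
  apply/eqP; apply: contraNT v0 => mm.
  have a0 : a * (m' * m - 1) == 0 by rewrite mulrBr mulr1 -aE subrr.
  have b0 : b * (m' * m - 1) == 0 by rewrite mulrBr mulr1 -bE subrr.
  move: a0 b0; rewrite !mulf_eq0 !subr_eq0 (negbTE mm) !orbF => /eqP-> /eqP->.
  by [].
have : m' \is a GRing.unit by apply/unitrPr; exists m.
rewrite vE' => /orP[]/eqP ->; [left|right].
  by rewrite mulr1z.
by rewrite mulrN1z.
Qed.
End lattice.

(** * Integration along an edge *)

Section edge.
Context {R : realType}.
Local Notation mu := (@lebesgue_measure R).
Implicit Types (v u : int * int) (p w : R * R) (f : R * R -> R).

Lemma edge_generator_bezout w v u (c : R) :
  c != 0 -> w = c *: lattice_point v -> u.1 * v.1 + u.2 * v.2 = 1 ->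
  edge_generator w = v \/ edge_generator w = - v.
Proof.
move=> c0 wE uv; have gv := lattice_generator_bezout c0 wE uv.
apply: (lattice_generator_opp gv).
  by rewrite /edge_generator; apply: xgetPex; exists v.
by apply: contra_eq_neq uv => ->; rewrite !mulr0 addr0 eq_sym oner_eq0.
Qed.

Lemma lattice_pointN v : lattice_point (- v) = - lattice_point v :> R * R.
Proof. by rewrite /lattice_point /= !mulrNz. Qed.

(** The two linear forms are coordinates adapted to the edge: the first
    vanishes on its line, and the second, by the Bezout relation, reads off
    the parameter [s] of [p + s *: v]. This makes the edge measurable and
    makes its preimage under a parametrization of the line an interval. *)
Lemma edge_sectionE v u (m : R) p : 0 < m ->
  u.1 * v.1 + u.2 * v.2 = 1 ->
  convex_hull [set p; p + m *: lattice_point v] =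
  (fun z => v.2%:~R * (z.1 - p.1) - v.1%:~R * (z.2 - p.2)) @^-1` [set 0] `&`
  (fun z => u.1%:~R * (z.1 - p.1) + u.2%:~R * (z.2 - p.2)) @^-1` `[0, m].
Proof.
move=> m0 uv; rewrite convex_hull2E addrC addKr.
have uvR : u.1%:~R * v.1%:~R + u.2%:~R * v.2%:~R = 1 :> R.
  by rewrite -!intrM -intrD uv.
apply/seteqP; split => z /=.
  case=> s /andP[s0 s1] ->; rewrite !scale_planeE /=; split; first ring.
  rewrite (_ : _ + _ = s * m); last first.
    by rewrite -[RHS]mulr1 -[X in _ = _ * X]uvR; ring.
  by rewrite in_itv/=; apply/andP; split; nra.
case=> z0; rewrite in_itv /= => /andP[].
set t := (X in 0 <= X) => t0 tm.
exists (t / m); first by rewrite divr_ge0 ?ler_pdivrMr ?mul1r ?(ltW m0).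
rewrite scalerA divfK ?gt_eqF// scale_planeE; apply: plane_eq => /=.
- rewrite -[LHS](subrK p.1) -[X in X + _]mul1r -[X in X * _ + _]uvR /t.
  have := congr1 ( *%R u.2%:~R) z0; rewrite mulr0; lra.
- rewrite -[LHS](subrK p.2) -[X in X + _]mul1r -[X in X * _ + _]uvR /t.
  have := congr1 ( *%R u.1%:~R) z0; rewrite mulr0; lra.
Qed.

Lemma measurable_edge v u (m : R) p : 0 < m -> u.1 * v.1 + u.2 * v.2 = 1 ->
  measurable (convex_hull [set p; p + m *: lattice_point v]).
Proof.
move=> m0 uv; rewrite (edge_sectionE p m0 uv); apply: measurableI.
- rewrite -[X in measurable X]setTI.
  apply: (_ : measurable_fun _ _) => //.
  apply: measurable_funB; apply: measurable_funM => //;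
    exact: measurable_funB.
- rewrite -[X in measurable X]setTI.
  apply: (_ : measurable_fun _ _) => //.
  apply: measurable_funD; apply: measurable_funM => //;
    exact: measurable_funB.
Qed.

(** Both generators of the edge are covered: [- v] runs through the edge over
    the reflected interval. *)
Lemma preimage_edge v u (m : R) p (g : int * int) (a b : R) : 0 < m ->
  u.1 * v.1 + u.2 * v.2 = 1 ->
  g = v /\ (a = 0 /\ b = m) \/ g = - v /\ (a = - m /\ b = 0) ->
  (fun s : R => p + s *: lattice_point g) @^-1`
    convex_hull [set p; p + m *: lattice_point v] = `[a, b]%classic.
Proof.
move=> m0 uv gE; rewrite (edge_sectionE p m0 uv).
have uvR : u.1%:~R * v.1%:~R + u.2%:~R * v.2%:~R = 1 :> R.
  by rewrite -!intrM -intrD uv.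
have Es s : u.1%:~R * (p.1 + s * v.1%:~R - p.1) +
            u.2%:~R * (p.2 + s * v.2%:~R - p.2) = s.
  by rewrite -[RHS]mulr1 -[X in _ = _ * X]uvR; ring.
have EsN s : u.1%:~R * (p.1 + s * - v.1%:~R - p.1) +
             u.2%:~R * (p.2 + s * - v.2%:~R - p.2) = - s.
  by rewrite -[in RHS](Es s); ring.
apply/seteqP; split => s /=; rewrite !in_itv/= /GRing.scale/=;
  case: gE => -[-> [-> ->]] /=; rewrite ?mulrNz ?Es ?EsN.
- by case.
- by case=> _ /andP[? ?]; apply/andP; split; lra.
- by move=> sm; split; first ring.
- by move=> /andP[? ?]; split; [ring | apply/andP; split; lra].
Qed.

(** The image measure of Lebesgue measure is transported back to the parameter
    line; when the selected generator is [- v], the reflection [s |-> - s]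
    brings the integral back to [[0, m]]. *)
Lemma edge_integral f v u (m : R) p q : 0 < m -> u.1 * v.1 + u.2 * v.2 = 1 ->
  q = p + m *: lattice_point v ->
  measurable_fun setT f ->
  (forall w, continuous (fun s : R => f (p + s *: w))) ->
  \int[line_measure p (q - p)]_(z in convex_hull [set p; q]) f z =
  \int[mu]_(s in `[0, m]) f (p + s *: lattice_point v).
Proof.
move=> m0 uv -> mf cf.
rewrite [p + _ - p]addrC addKr.
set w := m *: lattice_point v.
have mE := measurable_edge p m0 uv.
have gE : edge_generator w = v \/ edge_generator w = - v.
  by apply: (edge_generator_bezout _ _ uv) => //; rewrite gt_eqF.
have E a b :
    line_param p w @^-1` convex_hull [set p; p + w] = `[a, b]%classic ->
    \int[line_measure p w]_(z in convex_hull [set p; p + w]) f z =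
    \int[mu]_(s in `[a, b]) f (p + s *: lattice_point (edge_generator w)).
  move=> pre; rewrite /Rintegral; congr fine.
  have := @integral_pushforward _ _ (measurableTypeR R) (R * R)%type R
    (line_param p w) (measurable_line_param p w) mu
    (convex_hull [set p; p + w]) (EFin \o f).
  rewrite pre; apply => //.
  - exact/measurable_EFinP.
  - exact: (integrable_segment a b (cf (lattice_point (edge_generator w)))).
case: gE => gE.
  rewrite (E 0 m) ?gE// /line_param gE.
  by apply: (@preimage_edge v u m p) => //; left.
rewrite (E (- m) 0) ?gE//; last first.
  rewrite /line_param gE.
  by apply: (@preimage_edge v u m p) => //; right.
rewrite /Rintegral; congr fine.
have := @integration_by_substitution_oppr R
   (fun s => f (p + s *: lattice_point (- v))) 0 m (ltW m0).
rewrite oppr0 => -> /=.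
  by apply: eq_integral => s _; rewrite lattice_pointN scaleNr scalerN opprK.
exact: continuous_subspaceT.
Qed.
End edge.

(** * Integration over the region between two graphs *)

Section plane_region.
Context {R : realType}.
Local Notation mu := (@lebesgue_measure R).
Implicit Types (f : R * R -> R) (lo up : R -> R).

Definition region (x0 x1 : R) lo up : set (R * R) :=
  [set z | z.1 \in `[x0, x1] /\ z.2 \in `[lo z.1, up z.1]].

Lemma continuous_line f p w :
  continuous f -> continuous (fun s : R => f (p + s *: w)).
Proof.
move=> cf s; have cl : continuous (fun s : R => p + s *: w).
  by move=> t; apply: cvgD; [exact: cvg_cst | exact: scalel_continuous].
exact: continuous_comp (cl s) (cf _).
Qed.

Lemma continuous_section f x : continuous f -> continuous (fun y => f (x, y)).
Proof.
move=> cf.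
have -> : (fun y => f (x, y)) = fun s : R => f ((x, 0) + s *: (0, 1)).
  apply/funext => y; congr f; rewrite scale_planeE; apply: plane_eq => /=; ring.
exact: continuous_line.
Qed.

Lemma measurable_region x0 x1 lo up :
  measurable_fun setT lo -> measurable_fun setT up ->
  measurable (region x0 x1 lo up).
Proof.
move=> mlo mup.
have -> : region x0 x1 lo up =
    (`[x0, x1] `*` setT) `&`
    ((fun z => lo z.1 <= z.2) @^-1` [set true] `&`
     (fun z => z.2 <= up z.1) @^-1` [set true]).
  apply/seteqP; split => z; rewrite /region/= !in_itv/=.
    by case=> ? /andP[-> ->].
  by case=> -[? _] [-> ->].
apply: measurableI; first exact: measurableX.
apply: measurableI; rewrite -[X in measurable X]setTI.
- apply: (_ : measurable_fun _ _) => //; apply: measurable_fun_ler => //.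
  exact: measurableT_comp.
- apply: (_ : measurable_fun _ _) => //; apply: measurable_fun_ler => //.
  exact: measurableT_comp.
Qed.

Lemma continuous_box_bounded f (x0 x1 c d : R) : continuous f ->
  [bounded f z | z in `[x0, x1] `*` `[c, d]].
Proof.
move=> cf.
have cB : compact (`[x0, x1]%classic `*` `[c, d]%classic : set (R * R)).
  by apply: compact_setX; exact: segment_compact.
have /compact_bounded[M [_ mrt]] :=
  continuous_compact (continuous_subspaceT cf) cB.
by exists M; split; rewrite ?num_real // => ? ? ? ?; exact: mrt.
Qed.

(** Fubini, applied to [f] extended by zero.  Integrability holds since [f] is
    bounded on a box that contains the region. *)
Lemma region_integral f x0 x1 c d lo up :
  measurable_fun setT f -> continuous f ->
  measurable_fun setT lo -> measurable_fun setT up ->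
  (forall x, x \in `[x0, x1] -> c <= lo x /\ up x <= d) ->
  \int[(mu \x mu)%E]_(z in region x0 x1 lo up) f z =
  \int[mu]_(x in `[x0, x1]) \int[mu]_(y in `[lo x, up x]) f (x, y).
Proof.
move=> mf cf mlo mup bnd.
set D := region _ _ _ _.
have mD : measurable (D : set (measurableTypeR R * measurableTypeR R)).
  exact: measurable_region.
have DB : D `<=` `[x0, x1] `*` `[c, d].
  move=> z [z1 z2]; split => //=; have [cl ud] := bnd _ z1.
  move: z2; rewrite !in_itv/= => /andP[lz zu].
  by rewrite (le_trans cl lz) (le_trans zu ud).
have mB : measurable
    (`[x0, x1] `*` `[c, d] : set (measurableTypeR R * measurableTypeR R)).
  exact: measurableX.
have intf : (mu \x mu)%E.-integrable D (EFin \o f).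
  apply: (integrableS mB) => //.
  apply: measurable_bounded_integrable => //.
  - have E := @product_measure1E _ _ (measurableTypeR R) (measurableTypeR R) R
      mu mu `[x0, x1] `[c, d] (measurable_itv _) (measurable_itv _).
    have fin a b : (mu `[a, b] < +oo)%E.
      by rewrite lebesgue_measure_itv/=; case: ifP => // _; rewrite -EFinB ltry.
    rewrite [ltLHS]E; apply: lte_mul_pinfty; [by [] | | exact: fin].
    by rewrite ge0_fin_numE//; exact: fin.
  - have mf' : measurable_fun [set: measurableTypeR R * measurableTypeR R] f.
      exact: mf.
    exact: (measurable_funTS mf').
  - exact: continuous_box_bounded.
rewrite /Rintegral integral_mkcond -integral12_prod_meas1; last first.
  exact: (@integrable_mkcond _ _ R (mu \x mu)%E D (EFin \o f) mD).1 intf.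
rewrite [in RHS]integral_mkcond; congr fine; apply: eq_integral => x _.
rewrite /fubini_F !patchE; case: ifPn => [|xI].
  rewrite inE => xI.
  rewrite fineK; last first.
    apply: integrable_fin_num => //.
    by apply: integrable_segment; exact: continuous_section.
  rewrite [RHS]integral_mkcond; apply: eq_integral => y _; rewrite !patchE.
  congr (if _ then _ else _); apply/idP/idP; rewrite !inE.
    by case.
  by split.
rewrite integral0_eq// => y _; rewrite patchE memNset// => -[/= xI' _].
by move: xI; rewrite notin_setE.
Qed.

End plane_region.

(** * The pentagon as a region between two graphs *)

Section pentagon_region.
Context {R : realType}.
Variables (al ka : R).

Definition pentagon_vertices : seq (R * R) :=
  [:: (-1, - al - 2 * ka); (-1, al + 4); (0, al + 4); (1, al); (1, - al)].

Definition pentagon_lo (x : R) : R := ka * x + (- al - ka).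
Definition pentagon_up (x : R) : R := Num.min (al + 4) (al + 4 - 4 * x).

Lemma halfplane_conv (a b c s : R) (p q : R * R) : 0 <= s -> s <= 1 ->
  a * p.1 + b * p.2 <= c -> a * q.1 + b * q.2 <= c ->
  a * (s *: p + (1 - s) *: q).1 + b * (s *: p + (1 - s) *: q).2 <= c.
Proof.
move=> s0 s1 pc qc.
rewrite !scale_planeE /=.
have t0 : 0 <= 1 - s by rewrite subr_ge0.
have := mulr_ge0 s0 (_ : 0 <= c - (a * p.1 + b * p.2)).
have := mulr_ge0 t0 (_ : 0 <= c - (a * q.1 + b * q.2)).
rewrite !subr_ge0 => /(_ qc) + /(_ pc); lra.
Qed.

(** The constraints keep the shape [a * x + b * y <= c], zero coefficients
    included, so that [halfplane_conv] applies to each of them. *)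
Lemma pentagon_regionP z : region (-1) 1 pentagon_lo pentagon_up z <->
  [/\ -1 * z.1 + 0 * z.2 <= 1, 1 * z.1 + 0 * z.2 <= 1,
      ka * z.1 + -1 * z.2 <= al + ka, 0 * z.1 + 1 * z.2 <= al + 4
    & 4 * z.1 + 1 * z.2 <= al + 4].
Proof.
rewrite /region /= !in_itv /= /pentagon_lo /pentagon_up le_min.
split.
  by case=> /andP[? ?] /andP[? /andP[? ?]]; split; lra.
by case=> *; split; apply/andP; split; [lra|lra|lra|apply/andP; split; lra].
Qed.

(** The region is cut out by five half-planes, hence is convex.  Conversely
    the two ends of each vertical section lie on edges, so every point is a
    convex combination of two points that are themselves convex combinations
    of vertices. *)
Lemma pentagonE : 0 < al -> 0 <= ka ->
  polygon pentagon_vertices = region (-1) 1 pentagon_lo pentagon_up.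
Proof.
move=> al0 ka0.
apply/seteqP; split.
  apply: convex_hull_sub.
    move=> z /=; rewrite !inE => /orP[|/or4P[]] /eqP ->;
      apply/pentagon_regionP => /=; split; lra.
  move=> p q s s0 s1 /pentagon_regionP[p1 p2 p3 p4 p5].
  move=> /pentagon_regionP[q1 q2 q3 q4 q5].
  by apply/pentagon_regionP; split; apply: halfplane_conv.
have V p : p \in pentagon_vertices -> polygon pentagon_vertices p.
  by move=> pV; apply: convex_hull_mem.
move=> [x y] /pentagon_regionP[/= x0 x1 yl yu1 yu2].
have hL : polygon pentagon_vertices (x, pentagon_lo x).
  apply: (@convex_hull_conv _ _ (-1, - al - 2 * ka) (1, - al) _ ((1 - x) / 2)).
  - by apply: V; rewrite !inE eqxx ?orbT.
  - by apply: V; rewrite !inE eqxx ?orbT.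
  - lra.
  - lra.
  - by apply: plane_eq; rewrite !scale_planeE /pentagon_lo /=; field.
have hU : polygon pentagon_vertices (x, pentagon_up x).
  have [xn|xp] := lerP x 0.
    apply: (@convex_hull_conv _ _ (-1, al + 4) (0, al + 4) _ (- x)).
    - by apply: V; rewrite !inE eqxx ?orbT.
    - by apply: V; rewrite !inE eqxx ?orbT.
    - lra.
    - lra.
    - apply: plane_eq; rewrite !scale_planeE /pentagon_up /= ?min_l; lra.
  apply: (@convex_hull_conv _ _ (1, al) (0, al + 4) _ x).
  - by apply: V; rewrite !inE eqxx ?orbT.
  - by apply: V; rewrite !inE eqxx ?orbT.
  - lra.
  - lra.
  - apply: plane_eq; rewrite !scale_planeE /pentagon_up /= ?min_r; lra.
have lu : 0 < pentagon_up x - pentagon_lo x.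
  rewrite subr_gt0 /pentagon_lo /pentagon_up lt_min; apply/andP; split; nra.
apply: (@convex_hull_conv _ _ _ _ _
  ((pentagon_up x - y) / (pentagon_up x - pentagon_lo x)) hL hU).
- rewrite divr_ge0 ?(ltW lu)// subr_ge0 /pentagon_up le_min.
  by apply/andP; split; lra.
- rewrite ler_pdivrMr// mul1r /pentagon_lo; lra.
- apply: plane_eq; rewrite !scale_planeE /=; first ring.
  by field; rewrite gt_eqF.
Qed.

End pentagon_region.

(** * Products of affine functions over the pentagon *)

Section moments.
Context {R : realType}.
Local Notation mu := (@lebesgue_measure R).
Implicit Types (a b : R * R * R) (l u : R * R).

Definition affine a (z : R * R) : R := a.1.1 + a.1.2 * z.1 + a.2 * z.2.

Lemma measurable_affine a : measurable_fun setT (affine a).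
Proof.
by apply: measurable_funD; [apply: measurable_funD|];
   [|exact: measurable_funM..].
Qed.

Lemma continuous_affine a : continuous (affine a).
Proof.
move=> z; apply: cvgD; last by apply: cvgM; [exact: cvg_cst|exact: cvg_snd].
by apply: cvgD; [exact: cvg_cst|apply: cvgM; [exact: cvg_cst|exact: cvg_fst]].
Qed.

(** Trapezoidal rule on an edge of lattice length [m]. *)
Lemma edge_integral_affine (f : R * R -> R) b (v u : int * int) (m : R) p q :
  0 < m -> u.1 * v.1 + u.2 * v.2 = 1 -> q = p + m *: lattice_point v ->
  measurable_fun setT f -> continuous f ->
  (forall s, 0 <= s -> s <= m ->
     f (p + s *: lattice_point v) = affine b (p + s *: lattice_point v)) ->
  \int[line_measure p (q - p)]_(z in convex_hull [set p; q]) f z =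
  m * (affine b p + affine b q) / 2.
Proof.
move=> m0 uv qE mf cf fb.
rewrite (@edge_integral R f v u m p q)//; last first.
  by move=> w; exact: continuous_line.
rewrite (@Rintegral_simpson _ _ (fun s => affine b (p + s *: lattice_point v))).
- by rewrite qE /simpson /affine !scale_planeE/=; field.
- exact: ltW.
- exists (affine b p), (b.1.2 * v.1%:~R + b.2 * v.2%:~R), 0, 0 => x.
  by rewrite /affine !scale_planeE/=; ring.
- exact: fb.
Qed.

(** The integral of the product of two affine functions over the part of the
    strip [x0 <= x <= x1] between the lines [l.1 + l.2 * x] and
    [u.1 + u.2 * x]: Simpson's rule is exact in both directions, because the
    integral over a vertical section is again a cubic in [x]. *)
Definition trapezoid a b l u (x0 x1 : R) : R :=
  simpson (fun x => simpson (fun y => affine a (x, y) * affine b (x, y))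
                            (l.1 + l.2 * x) (u.1 + u.2 * x)) x0 x1.

Lemma cubic_fiber a b x : cubic (fun y => affine a (x, y) * affine b (x, y)).
Proof.
exists ((a.1.1 + a.1.2 * x) * (b.1.1 + b.1.2 * x)),
  ((a.1.1 + a.1.2 * x) * b.2 + a.2 * (b.1.1 + b.1.2 * x)), (a.2 * b.2), 0 => y.
by rewrite /affine /=; ring.
Qed.

Lemma cubic_fiber_integral a b l u :
  cubic (fun x => simpson (fun y => affine a (x, y) * affine b (x, y))
                          (l.1 + l.2 * x) (u.1 + u.2 * x)).
Proof.
case: a b l u => [[a0 a1] a2] [[b0 b1] b2] [l0 l1] [u0 u1] /=.
pose g00 := a0 * b0; pose g10 := a0 * b1 + a1 * b0.
pose g01 := a0 * b2 + a2 * b0; pose g20 := a1 * b1.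
pose g11 := a1 * b2 + a2 * b1; pose g02 := a2 * b2.
pose c0 s0 := g00 * s0 + g01 * s0 ^+ 2 / 2 + g02 * s0 ^+ 3 / 3.
pose c1 s0 s1 := g00 * s1 + g10 * s0 + g01 * s0 * s1 + g11 * s0 ^+ 2 / 2
  + g02 * s0 ^+ 2 * s1.
pose c2 s0 s1 := g10 * s1 + g20 * s0 + g01 * s1 ^+ 2 / 2 + g11 * s0 * s1
  + g02 * s0 * s1 ^+ 2.
pose c3 s1 := g20 * s1 + g11 * s1 ^+ 2 / 2 + g02 * s1 ^+ 3 / 3.
(* c0, ..., c3 are the coefficients in x of the antiderivative in y of the
   quadratic integrand, evaluated on a line s0 + s1 x. *)
exists (c0 u0 - c0 l0), (c1 u0 u1 - c1 l0 l1), (c2 u0 u1 - c2 l0 l1),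
  (c3 u1 - c3 l1) => x.
rewrite /c0 /c1 /c2 /c3 /g00 /g10 /g01 /g20 /g11 /g02 /simpson /affine /=.
by field.
Qed.

(** The upper boundary breaks at [x = 0], which cuts the pentagon into two
    trapezoids. Only the integrals over vertical sections enter, and they have
    to be those of the affine function [b] above the line [l]: for an affine
    [f] this line is the bottom edge, and for the crease it is the line where
    the crease starts. *)
Lemma pentagon_integral (f : R * R -> R) a b (al ka : R) l :
  0 < al -> 0 <= ka -> measurable_fun setT f -> continuous f ->
  (forall x, -1 <= x -> x <= 1 ->
    \int[mu]_(y in `[pentagon_lo al ka x, pentagon_up al x])
      (affine a (x, y) * f (x, y)) =
    simpson (fun y => affine a (x, y) * affine b (x, y))
       (l.1 + l.2 * x) (pentagon_up al x)) ->
  \int[(lebesgue_measure \x lebesgue_measure)%E]_(z in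
      polygon (pentagon_vertices al ka)) (affine a z * f z) =
  trapezoid a b l (al + 4, 0) (-1) 0 + trapezoid a b l (al + 4, - 4) 0 1.
Proof.
move=> al0 ka0 mf cf fiber.
rewrite pentagonE//.
rewrite (@region_integral _ (fun z => affine a z * f z) (-1) 1
  (- al - 2 * ka) (al + 4)); first last.
- move=> x; rewrite in_itv /= => /andP[x0 x1].
  rewrite /pentagon_lo /pentagon_up ge_min lexx/=; split => //; nra.
- apply: continuous_measurable_fun => x.
  have c1 : continuous (fun x : R => al + 4 - 4 * x).
    by move=> y; apply: cvgB; [exact: cvg_cst | exact: mulrl_continuous].
  exact: (@continuous_min _ _ (cst (al + 4)) _ x (cvg_cst _) (c1 x)).
- apply: continuous_measurable_fun => x.
  by apply: cvgD; [exact: mulrl_continuous | exact: cvg_cst].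
- by move=> z; apply: cvgM; [exact: continuous_affine | exact: cf].
- by apply: measurable_funM => //; exact: measurable_affine.
rewrite (@Rintegral_piecewise _ _
  (fun x => simpson (fun y => affine a (x, y) * affine b (x, y))
     (l.1 + l.2 * x) ((al + 4) + 0 * x))
  (fun x => simpson (fun y => affine a (x, y) * affine b (x, y))
     (l.1 + l.2 * x) ((al + 4) + - 4 * x)) _ 0)//.
- exact: (cubic_fiber_integral a b l (_, _)).
- exact: (cubic_fiber_integral a b l (_, _)).
- move=> x x0 x1; rewrite fiber//; last lra.
  by rewrite /pentagon_up min_l; [congr simpson; ring | lra].
- move=> x x0 x1; rewrite fiber//; last lra.
  by rewrite /pentagon_up min_r; [congr simpson; ring | lra].
Qed.

End moments.

(** * The functional on affine functions and on creases *)

Section functional.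
Context {R : realType}.
Local Notation mu := (@lebesgue_measure R).
Implicit Types (f : R * R -> R) (a b : R * R * R) (al h : R).

(** The lattice lengths of the edges are [2 al + 2 k + 4], 1, 1, [2 al] and 2;
    [f] is affine on the two top edges and on the bottom edge, and its
    integrals over the two vertical edges are left as parameters. *)
Lemma boundary_pentagon f (bt bb : R * R * R) al (k : nat) (Il Ir : R) :
  0 < al -> measurable_fun setT f -> continuous f ->
  \int[mu]_(s in `[0, 2 * al + 2 * k%:R + 4])
    f (-1, - al - 2 * k%:R + s) = Il ->
  \int[mu]_(s in `[0, 2 * al]) f (1, al - s) = Ir ->
  (forall x, -1 <= x -> x <= 0 -> f (x, al + 4) = affine bt (x, al + 4)) ->
  (forall x, 0 <= x -> x <= 1 ->
     f (x, al + 4 - 4 * x) = affine bt (x, al + 4 - 4 * x)) ->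
  (forall x, -1 <= x -> x <= 1 ->
     f (x, pentagon_lo al k%:R x) = affine bb (x, pentagon_lo al k%:R x)) ->
  boundary_integral (pentagon_vertices al k%:R) f =
  Il + (affine bt (-1, al + 4) + affine bt (0, al + 4)) / 2
  + (affine bt (0, al + 4) + affine bt (1, al)) / 2
  + Ir + (affine bb (1, - al) + affine bb (-1, - al - 2 * k%:R)).
Proof.
move=> al0 mf cf left right top slope low.
have k0 : 0 <= k%:R :> R by [].
rewrite /boundary_integral /edges /pentagon_vertices /= !big_cons big_nil /=.
rewrite (@edge_integral _ f (0, 1) (0, 1) (2 * al + 2 * k%:R + 4))//;
  first last.
- by move=> w; exact: continuous_line.
- by apply: plane_eq; rewrite !scale_planeE /lattice_point /=; ring.
- lra.
rewrite (@edge_integral_affine _ f bt (1, 0) (1, 0) 1)//; first last.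
- move=> s s0 s1.
  rewrite (_ : _ + _ = (-1 + s, al + 4)); first by apply: top; lra.
  by apply: plane_eq; rewrite !scale_planeE /lattice_point /=; ring.
- by apply: plane_eq; rewrite !scale_planeE /lattice_point /=; ring.
rewrite (@edge_integral_affine _ f bt (1, -4) (1, 0) 1)//; first last.
- move=> s s0 s1.
  rewrite (_ : _ + _ = (s, al + 4 - 4 * s)); first by apply: slope; lra.
  by apply: plane_eq; rewrite !scale_planeE /lattice_point /=; ring.
- by apply: plane_eq; rewrite !scale_planeE /lattice_point /=; ring.
rewrite (@edge_integral _ f (0, -1) (0, -1) (2 * al))//; first last.
- by move=> w; exact: continuous_line.
- by apply: plane_eq; rewrite !scale_planeE /lattice_point /=; ring.
- lra.
rewrite (@edge_integral_affine _ f bb (-1, - k%:Z) (-1, 0) 2)//; first last.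
- move=> s s0 s1.
  rewrite (_ : _ + _ = (1 - s, pentagon_lo al k%:R (1 - s))).
    by apply: low; lra.
  apply: plane_eq; rewrite !scale_planeE /lattice_point /pentagon_lo /=.
    by ring.
  by rewrite mulrNz; ring.
- by apply: plane_eq; rewrite !scale_planeE /lattice_point /= ?mulrNz; ring.
- by rewrite /= mul0r addr0 mulrNN mul1r.
rewrite [X in X + _ = _](_ : _ = Il); last first.
  rewrite -left; apply: eq_Rintegral => s _; congr f.
  by apply: plane_eq; rewrite !scale_planeE /lattice_point /=; ring.
rewrite [X in _ + (_ + (_ + (X + _))) = _](_ : _ = Ir); last first.
  rewrite -right; apply: eq_Rintegral => s _; congr f.
  by apply: plane_eq; rewrite !scale_planeE /lattice_point /=; ring.
by field.
Qed.

Definition affine_value al (ka : R) a b : R :=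
  (2 * al + 2 * ka + 4) *
    (affine b (-1, - al - 2 * ka) + affine b (-1, al + 4)) / 2
  + (affine b (-1, al + 4) + affine b (0, al + 4)) / 2
  + (affine b (0, al + 4) + affine b (1, al)) / 2
  + 2 * al * (affine b (1, al) + affine b (1, - al)) / 2
  + (affine b (1, - al) + affine b (-1, - al - 2 * ka))
  - (trapezoid a b (- al - ka, ka) (al + 4, 0) (-1) 0
     + trapezoid a b (- al - ka, ka) (al + 4, - 4) 0 1).

Lemma functional_affine al (k : nat) a b : 0 < al ->
  functional_with (pentagon_vertices al k%:R) a (affine b) =
  affine_value al k%:R a b.
Proof.
move=> al0.
have k0 : 0 <= k%:R :> R by [].
have vert x c e m : 0 <= m -> \int[mu]_(s in `[0, m]) affine b (x, c + e * s) =
    m * (affine b (x, c) + affine b (x, c + e * m)) / 2.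
  move=> m0; rewrite Rintegral_cubic//.
    by rewrite /simpson /affine /=; field.
  exists (affine b (x, c)), (b.2 * e), 0, 0 => s; rewrite /affine /=; ring.
rewrite /functional_with (@boundary_pentagon _ b b _ _
  ((2 * al + 2 * k%:R + 4) *
    (affine b (-1, - al - 2 * k%:R) + affine b (-1, al + 4)) / 2)
  (2 * al * (affine b (1, al) + affine b (1, - al)) / 2))//; first last.
- transitivity (\int[mu]_(s in `[0, 2 * al]) affine b (1, al + -1 * s)).
    by apply: eq_Rintegral => s _; rewrite mulN1r.
  rewrite vert; last lra.
  by congr (_ * (_ + affine b (_, _)) / _); ring.
- transitivity (\int[mu]_(s in `[0, 2 * al + 2 * k%:R + 4])
     affine b (-1, - al - 2 * k%:R + 1 * s)).
    by apply: eq_Rintegral => s _; rewrite mul1r.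
  rewrite vert; last lra.
  by congr (_ * (_ + affine b (_, _)) / _); ring.
- exact: continuous_affine.
- exact: measurable_affine.
congr (_ - _).
apply: (pentagon_integral (l := (- al - k%:R, k%:R))) => //.
- exact: measurable_affine.
- exact: continuous_affine.
move=> x x0 x1; rewrite Rintegral_cubic.
- by rewrite /pentagon_lo addrC.
- by rewrite /pentagon_lo /pentagon_up le_min; apply/andP; split; nra.
- exact: cubic_fiber.
Qed.

(** With [h <= 2 * al] the crease does not start below the vertex [(1, - al)],
    so it vanishes on the bottom edge, is affine on the two top edges and
    breaks only on the two vertical edges. *)
Lemma functional_crease al h (k : nat) a : 0 < al -> 0 <= h -> h <= 2 * al ->
  functional_with (pentagon_vertices al k%:R) a
    (fun z => Num.max (z.2 - al + h) 0) =
  (h ^+ 2 + 6 * h + 14)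
  - (trapezoid a (h - al, 0, 1) (al - h, 0) (al + 4, 0) (-1) 0
     + trapezoid a (h - al, 0, 1) (al - h, 0) (al + 4, - 4) 0 1).
Proof.
move=> al0 h0 h2.
have k0 : 0 <= k%:R :> R by [].
set f := fun z => _.
have cf : continuous f.
  have c1 : continuous (fun z : R * R => z.2 - al + h).
    move=> z; apply: cvgD; last exact: cvg_cst.
    by apply: cvgB; [exact: cvg_snd | exact: cvg_cst].
  by move=> z; exact: (@continuous_max _ _ _ (cst 0) z (c1 z) (cvg_cst _)).
have mf : measurable_fun setT f.
  apply: measurable_maxr => //; apply: measurable_funD => //.
  exact: measurable_funB.
have fb z : al - h <= z.2 -> f z = affine (h - al, 0, 1) z.
  by move=> hz; rewrite /f /affine /= max_l; lra.
have f0 z : z.2 <= al - h -> f z = 0.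
  by move=> hz; rewrite /f max_r//; lra.
rewrite /functional_with (@boundary_pentagon f (h - al, 0, 1) 0 _ _
  ((h + 4) ^+ 2 / 2) (h ^+ 2 / 2))//; first last.
- move=> x x0 x1; rewrite f0.
    by rewrite /affine /= !mul0r !addr0.
  rewrite /pentagon_lo /=; nra.
- by move=> x x0 x1; rewrite fb//=; lra.
- by move=> x x0 x1; rewrite fb//=; lra.
- rewrite (@Rintegral_piecewise _ _ (fun s => h - s) (fun=> 0) 0 h)//.
  + by rewrite /simpson; field.
  + by exists h, (-1), 0, 0 => s; ring.
  + by exists 0, 0, 0, 0 => s; ring.
  + by move=> s s0 sh; rewrite fb /affine /=; lra.
  + by move=> s hs s2; rewrite f0 //=; lra.
- rewrite (@Rintegral_piecewise _ _ (fun=> 0)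
    (fun s => s - (2 * al + 2 * k%:R - h)) 0 (2 * al + 2 * k%:R - h))//.
  + by rewrite /simpson; field.
  + lra.
  + lra.
  + by exists 0, 0, 0, 0 => s; ring.
  + by exists (- (2 * al + 2 * k%:R - h)), 1, 0, 0 => s; ring.
  + by move=> s s0 sh; rewrite f0 //=; lra.
  + by move=> s hs s2; rewrite fb /affine /=; lra.
congr (_ - _); first by rewrite /affine /=; field.
apply: (pentagon_integral (l := (al - h, 0))) => //.
move=> x x0 x1 /=.
rewrite (@Rintegral_piecewise _ _ (fun=> 0)
    (fun y => affine a (x, y) * affine (h - al, 0, 1) (x, y)) _
    (al - h + 0 * x)).
- by rewrite /simpson !(mulr0, add0r).
- rewrite /pentagon_lo; nra.
- rewrite /pentagon_up le_min; apply/andP; split; lra.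
- by exists 0, 0, 0, 0 => y; ring.
- exact: cubic_fiber.
- by move=> y ly yl; rewrite f0 ?mulr0//=; lra.
- by move=> y ly _; rewrite fb//=; lra.
Qed.
End functional.

(** * Positivity of the eliminated functional *)

Section inequality.
Context {R : realType}.
Implicit Types (b k h : R).

(** Cramer's rule for a symmetric system, in the form that computes an affine
    function of the solution: the [cij] are the cofactors of the matrix. *)
Lemma cramer3 (m00 m01 m02 m11 m12 m22 r0 r1 r2 x y z c u0 u1 u2 : R) :
  m00 * x + m01 * y + m02 * z = r0 -> m01 * x + m11 * y + m12 * z = r1 ->
  m02 * x + m12 * y + m22 * z = r2 ->
  let c00 := m11 * m22 - m12 ^+ 2 in
  let c01 := m02 * m12 - m01 * m22 in
  let c02 := m01 * m12 - m02 * m11 in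
  let c11 := m00 * m22 - m02 ^+ 2 in
  let c12 := m01 * m02 - m00 * m12 in
  let c22 := m00 * m11 - m01 ^+ 2 in
  let D := m00 * c00 + m01 * c01 + m02 * c02 in
  D * (c - (x * u0 + y * u1 + z * u2)) =
  D * c - (u0 * (c00 * r0 + c01 * r1 + c02 * r2)
         + u1 * (c01 * r0 + c11 * r1 + c12 * r2)
         + u2 * (c02 * r0 + c12 * r1 + c22 * r2)).
Proof. by move=> <- <- <- /=; ring. Qed.

(** This is 27 times the determinant of the moment matrix of the pentagon, the
    Gram matrix of [1], [x], [y], for [al = b * k ^+ 2]. *)
Definition moment_det b k : R :=
  192 * b ^+ 5 * k ^+ 10 + 480 * b ^+ 4 * k ^+ 9 + 1392 * b ^+ 4 * k ^+ 8
  + 512 * b ^+ 3 * k ^+ 8 + 2912 * b ^+ 3 * k ^+ 7 + 288 * b ^+ 2 * k ^+ 7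
  + 4256 * b ^+ 3 * k ^+ 6 + 2400 * b ^+ 2 * k ^+ 6 + 80 * b * k ^+ 6
  + 6864 * b ^+ 2 * k ^+ 5 + 880 * b * k ^+ 5 + 8 * k ^+ 5
  + 6720 * b ^+ 2 * k ^+ 4 + 3712 * b * k ^+ 4 + 112 * k ^+ 4
  + 7136 * b * k ^+ 3 + 632 * k ^+ 3 + 5264 * b * k ^+ 2 + 1808 * k ^+ 2
  + 2632 * k + 1560.

(** The functions [coef0], ..., [coef3] are the coefficients of the powers of
    [h] in [moment_det b k] times the value of the functional at
    [max (y - al + h) 0]. *)
Definition coef0 b k : R :=
  640 * b ^+ 5 * k ^+ 10 + 960 * b ^+ 4 * k ^+ 9 + 5408 * b ^+ 4 * k ^+ 8
  + 768 * b ^+ 3 * k ^+ 8 + 9408 * b ^+ 3 * k ^+ 7 + 352 * b ^+ 2 * k ^+ 7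
  + 16448 * b ^+ 3 * k ^+ 6 + 6208 * b ^+ 2 * k ^+ 6 + 128 * b * k ^+ 6
  + 21184 * b ^+ 2 * k ^+ 5 + 1952 * b * k ^+ 5 + 32 * k ^+ 5
  + 18656 * b ^+ 2 * k ^+ 4 + 9024 * b * k ^+ 4 + 352 * k ^+ 4
  + 14912 * b * k ^+ 3 + 1632 * k ^+ 3 + 6240 * b * k ^+ 2 + 3632 * k ^+ 2
  + 3120 * k.

Definition coef1 b k : R :=
  - 256 * b ^+ 4 * k ^+ 9 + 640 * b ^+ 4 * k ^+ 8 - 320 * b ^+ 3 * k ^+ 8
  + 768 * b ^+ 3 * k ^+ 7 - 160 * b ^+ 2 * k ^+ 7 + 1376 * b ^+ 3 * k ^+ 6
  + 240 * b ^+ 2 * k ^+ 6 + 528 * b ^+ 2 * k ^+ 5 + 176 * b * k ^+ 5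
  + 16 * k ^+ 5 - 3536 * b ^+ 2 * k ^+ 4 + 144 * b * k ^+ 4 + 144 * k ^+ 4
  - 3952 * b * k ^+ 3 + 448 * k ^+ 3 - 8128 * b * k ^+ 2 + 96 * k ^+ 2
  - 2192 * k - 3120.

Definition coef2 b k : R :=
  192 * b ^+ 4 * k ^+ 8 + 32 * b ^+ 3 * k ^+ 8 + 512 * b ^+ 3 * k ^+ 7
  + 48 * b ^+ 2 * k ^+ 7 + 272 * b ^+ 3 * k ^+ 6 + 552 * b ^+ 2 * k ^+ 6
  + 32 * b * k ^+ 6 + 696 * b ^+ 2 * k ^+ 5 + 328 * b * k ^+ 5 + 8 * k ^+ 5
  - 1176 * b ^+ 2 * k ^+ 4 + 856 * b * k ^+ 4 + 88 * k ^+ 4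
  - 232 * b * k ^+ 3 + 368 * k ^+ 3 - 2080 * b * k ^+ 2 + 608 * k ^+ 2
  + 40 * k - 600.

Definition coef3 b k : R :=
  - 96 * b ^+ 3 * k ^+ 6 - 144 * b ^+ 2 * k ^+ 5 - 376 * b ^+ 2 * k ^+ 4
  - 56 * b * k ^+ 4 - 312 * b * k ^+ 3 - 4 * k ^+ 3 - 432 * b * k ^+ 2
  - 40 * k ^+ 2 - 128 * k - 132.

Lemma monomial_ge0 b k (i j : nat) : 1 / 3 <= b -> 10 <= k ->
  0 <= b ^+ i * k ^+ j.
Proof. by move=> b3 k10; rewrite mulr_ge0// exprn_ge0//; lra. Qed.

(** Since [1 <= 3 * b] and [10 <= k], raising the degree of a monomial
    multiplies it by a definite amount. The lower order monomials in the
    coefficients are absorbed in this way by monomials of higher degree. *)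
Lemma monomial_le b k (i j m n : nat) : 1 / 3 <= b -> 10 <= k ->
  10 ^+ n * (b ^+ i * k ^+ j) <= 3 ^+ m * (b ^+ (i + m) * k ^+ (j + n)).
Proof.
move=> b3 k10.
rewrite -[X in X <= _]mul1r !exprD.
rewrite (_ : 3 ^+ m * _ = (3 * b) ^+ m * (b ^+ i * k ^+ j * k ^+ n));
  last by rewrite exprMn; ring.
apply: ler_pM => //.
- by rewrite mulr_ge0 ?monomial_ge0// exprn_ge0.
- by apply: exprn_ege1; lra.
- rewrite mulrC ler_wpM2l ?monomial_ge0//.
  by apply: lerXn2r; rewrite ?nnegrE//; lra.
Qed.

Lemma moment_det_gt0 b k : 1 / 3 <= b -> 10 <= k -> 0 < moment_det b k.
Proof.
move=> b3 k10; have P i j := monomial_ge0 i j b3 k10.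
rewrite /moment_det.
have := P 5 10; have := P 4 9; have := P 4 8; have := P 3 8; have := P 3 7.
have := P 2 7; have := P 3 6; have := P 2 6; have := P 1 6; have := P 2 5.
have := P 1 5; have := P 0 5; have := P 2 4; have := P 1 4; have := P 0 4.
have := P 1 3; have := P 0 3; have := P 1 2; have := P 0 2; have := P 0 1.
by lra.
Qed.

Lemma coef0_ge b k : 1 / 3 <= b -> 10 <= k ->
  144 * (b ^+ 4 * k ^+ 10) <= coef0 b k.
Proof.
move=> b3 k10; have P i j := monomial_ge0 i j b3 k10.
rewrite /coef0.
have := monomial_le 4 10 1 0 b3 k10.
have := P 4 10; have := P 4 9; have := P 4 8; have := P 3 8; have := P 3 7.
have := P 2 7; have := P 3 6; have := P 2 6; have := P 1 6; have := P 2 5.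
have := P 1 5; have := P 0 5; have := P 2 4; have := P 1 4; have := P 0 4.
have := P 1 3; have := P 0 3; have := P 1 2; have := P 0 2; have := P 0 1.
by lra.
Qed.

Lemma coef1_ge b k : 1 / 3 <= b -> 10 <= k ->
  - (288 * (b ^+ 4 * k ^+ 9)) <= coef1 b k.
Proof.
move=> b3 k10; have P i j := monomial_ge0 i j b3 k10.
have Q i j m n := monomial_le i j m n b3 k10.
rewrite /coef1.
have := Q 4 8 0 1; have := Q 3 8 1 0; have := Q 2 7 1 0; have := Q 2 4 1 2.
have := Q 1 3 1 2; have := Q 1 2 0 2; have := Q 0 1 0 4; have := Q 0 0 0 5.
have := P 4 8; have := P 3 7; have := P 2 6; have := P 1 5; have := P 0 4.
have := P 0 3; have := P 0 2; have := P 1 3; have := P 1 2.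
have := P 3 6; have := P 0 1.
by lra.
Qed.

Lemma coef2_ge b k : 1 / 3 <= b -> 10 <= k ->
  192 * (b ^+ 4 * k ^+ 8) <= coef2 b k.
Proof.
move=> b3 k10; have P i j := monomial_ge0 i j b3 k10.
have Q i j m n := monomial_le i j m n b3 k10.
rewrite /coef2.
have := Q 2 4 1 2; have := Q 1 3 1 2; have := Q 1 2 0 2; have := Q 0 0 0 4.
have := P 3 8; have := P 3 7; have := P 2 7; have := P 2 6; have := P 1 6.
have := P 1 5; have := P 0 5; have := P 0 3; have := P 0 2; have := P 0 1.
have := P 2 4; have := P 1 3; have := P 1 2.
by lra.
Qed.

Lemma coef3_ge b k : 1 / 3 <= b -> 10 <= k ->
  - (192 * (b ^+ 3 * k ^+ 6)) <= coef3 b k.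
Proof.
move=> b3 k10; have P i j := monomial_ge0 i j b3 k10.
have Q i j m n := monomial_le i j m n b3 k10.
rewrite /coef3.
have := Q 2 5 1 1; have := Q 2 4 1 2; have := Q 1 4 2 2; have := Q 1 3 2 3.
have := Q 0 3 3 3; have := Q 1 2 2 4; have := Q 0 2 3 4; have := Q 0 1 3 5.
have := Q 0 0 3 6; have := P 3 6.
by lra.
Qed.

(** The cubic term costs at most [48 * b ^+ 4 * k ^+ 8 * h ^+ 2], as
    [h <= b * k ^+ 2 / 4]; what the bounds on the coefficients then leave is
    [144 * b ^+ 4 * k ^+ 8 * (k - h) ^+ 2]. *)
Lemma margin_ge0 b k h :
  1 / 3 <= b -> 10 <= k -> 0 <= h -> h <= b * k ^+ 2 / 4 ->
  0 <= coef0 b k + coef1 b k * h + coef2 b k * h ^+ 2 + coef3 b k * h ^+ 3.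
Proof.
move=> b3 k10 h0 hb.
have c0 := coef0_ge b3 k10.
have c1 := ler_wpM2r h0 (coef1_ge b3 k10).
have c2 := ler_wpM2r (exprn_ge0 2 h0) (coef2_ge b3 k10).
have c3 := ler_wpM2r (exprn_ge0 3 h0) (coef3_ge b3 k10).
have ch : b ^+ 3 * k ^+ 6 * h ^+ 3 <= b ^+ 4 * k ^+ 8 / 4 * h ^+ 2.
  have -> : b ^+ 3 * k ^+ 6 * h ^+ 3 = b ^+ 3 * k ^+ 6 * h ^+ 2 * h by ring.
  have -> : b ^+ 4 * k ^+ 8 / 4 * h ^+ 2 =
            b ^+ 3 * k ^+ 6 * h ^+ 2 * (b * k ^+ 2 / 4) by field.
  by rewrite ler_wpM2l// mulr_ge0 ?exprn_ge0// monomial_ge0.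
have sq : 0 <= b ^+ 4 * k ^+ 8 * (k - h) ^+ 2.
  by rewrite mulr_ge0 ?sqr_ge0// monomial_ge0.
by lra.
Qed.

End inequality.

(** * Elimination of the affine weight *)

Section crease_value.
Context {R : realType}.

(** The three vanishing conditions are a linear system for [a] whose matrix
    [m] holds the second moments of the pentagon and whose right-hand side [r]
    holds its boundary moments; the [u] are the moments of the crease. The
    determinant eliminates [a]. *)
Lemma crease_value_scaled (al h b : R) (k : nat) a :
  0 < al -> al = b * k%:R ^+ 2 ->
  vanishes_on_affine (pentagon_vertices al k%:R) a -> 0 <= h -> h <= 2 * al ->
  moment_det b k%:R *
    functional_with (pentagon_vertices al k%:R) a
      (fun z => Num.max (z.2 - al + h) 0) =
  coef0 b k%:R + coef1 b k%:R * h + coef2 b k%:R * h ^+ 2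
  + coef3 b k%:R * h ^+ 3.
Proof.
move=> al0 alE [V0 V1 V2] h0 h2.
rewrite functional_crease//.
have A0 : (fun=> 1) = affine (1, 0, 0) :> (R * R -> R).
  by apply/funext => z; rewrite /affine /=; ring.
have A1 : fst = affine (0, 1, 0) :> (R * R -> R).
  by apply/funext => z; rewrite /affine /=; ring.
have A2 : snd = affine (0, 0, 1) :> (R * R -> R).
  by apply/funext => z; rewrite /affine /=; ring.
move: V0 V1 V2.
rewrite A0 [fun z => z.1]A1 [fun z => z.2]A2 !functional_affine//.
case: a => [[a0 a1] a2]; move: (k%:R : R) alE => ka alE.
pose m00 := 4 * al + 2 * ka + 6.
pose m01 := - (2 / 3 * ka + 4 / 3).
pose m02 := - 2 * ka * al + 6 * al - 4 / 3 * ka ^+ 2 + 32 / 3.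
pose m11 := 4 / 3 * al + 2 / 3 * ka + 5 / 3.
pose m12 := 2 / 3 * ka * al - 4 / 3 * al + 2 / 3 * ka ^+ 2 - 10 / 3.
pose m22 := 4 / 3 * al ^+ 3 + 2 * ka * al ^+ 2 + 6 * al ^+ 2
  + 8 / 3 * ka ^+ 2 * al + 4 / 3 * ka ^+ 3 + 64 / 3 * al + 80 / 3.
pose r0 := 4 * al + 2 * ka + 8.
pose r1 := - 2 * ka - 4.
pose r2 := - 2 * ka * al + 4 * al - 2 * ka ^+ 2 - 2 * ka + 14.
pose u0 := h ^+ 2 + 6 * h + 32 / 3.
pose u1 := - 4 / 3 * h - 10 / 3.
pose u2 := al * u0 - h ^+ 3 / 3 + 32 / 3 * h + 80 / 3.
have -> : affine_value al ka (a0, a1, a2) (1, 0, 0) =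
    r0 - (m00 * a0 + m01 * a1 + m02 * a2).
  rewrite /affine_value /trapezoid /simpson /affine /r0 /m00 /m01 /m02 /=.
  by field.
have -> : affine_value al ka (a0, a1, a2) (0, 1, 0) =
    r1 - (m01 * a0 + m11 * a1 + m12 * a2).
  rewrite /affine_value /trapezoid /simpson /affine /r1 /m01 /m11 /m12 /=.
  by field.
have -> : affine_value al ka (a0, a1, a2) (0, 0, 1) =
    r2 - (m02 * a0 + m12 * a1 + m22 * a2).
  rewrite /affine_value /trapezoid /simpson /affine /r2 /m02 /m12 /m22 /=.
  by field.
move=> /subr0_eq/esym E0 /subr0_eq/esym E1 /subr0_eq/esym E2.
have -> : trapezoid (a0, a1, a2) (h - al, 0, 1) (al - h, 0) (al + 4, 0) (-1) 0
    + trapezoid (a0, a1, a2) (h - al, 0, 1) (al - h, 0) (al + 4, - 4) 0 1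
    = a0 * u0 + a1 * u1 + a2 * u2.
  by rewrite /trapezoid /simpson /affine /u2 /u1 /u0 /=; field.
have /= := cramer3 (h ^+ 2 + 6 * h + 14) u0 u1 u2 E0 E1 E2.
set D := (D in D * _ = D * _ - _).
have DE : moment_det b ka = 27 * D.
  rewrite /D /moment_det /m00 /m01 /m02 /m11 /m12 /m22 alE; by field.
move=> E; rewrite DE -mulrA E.
rewrite /D /coef0 /coef1 /coef2 /coef3 /r0 /r1 /r2 /u2 /u1 /u0.
rewrite /m00 /m01 /m02 /m11 /m12 /m22 alE.
by field.
Qed.

End crease_value.

(** * Nonnegativity on the creases *)

Theorem theorem4p1 (R : realType) (beta : R) (hbeta : 1 / 3 <= beta) :
  exists (K : nat) (c : R), 0 < c /\
    forall (k : nat) (t : R), (0 < k)%N -> (K <= k)%N -> 0 < t -> t <= c * k%:R ->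
      0 <= relK_functional (pentagon beta k) (crease beta k t).
Proof.
(* The bound [h <= al / 4] keeps the crease above the bottom edge, and is the
   one under which the cubic term is absorbed in [margin_ge0]. *)
exists 10%N, (beta / 4); split; first lra.
move=> k t _ k10 t0 tk.
have k10R : 10 <= k%:R :> R by rewrite ler_nat.
pose al := beta * k%:R ^+ 2; pose h := k%:R * t.
have k2 : 100 <= k%:R ^+ 2 :> R by nra.
have al0 : 0 < al by rewrite /al; nra.
have h0 : 0 <= h by rewrite /h; nra.
have hal : h <= al / 4.
  have := ler_wpM2l (_ : 0 <= k%:R) tk; rewrite /h /al; lra.
have h2 : h <= 2 * al by lra.
rewrite /relK_functional -/(pentagon_vertices al k%:R).
rewrite /pentagon -/al -[[:: _; _; _; _; _]]/(pentagon_vertices al k%:R).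
have -> : crease beta k t = fun z => Num.max (z.2 - al + h) 0 by [].
case: (pselect (exists a, vanishes_on_affine (pentagon_vertices al k%:R) a)).
  move=> exa.
  have Va : vanishes_on_affine (pentagon_vertices al k%:R)
      (xget 0 (vanishes_on_affine (pentagon_vertices al k%:R))).
    exact: xgetPex.
  have E := crease_value_scaled al0 (erefl al) Va h0 h2.
  rewrite -(pmulr_rge0 _ (moment_det_gt0 hbeta k10R)) E.
  exact: margin_ge0.
move=> nexa; rewrite xgetPN; last by move=> a Va; apply: nexa; exists a.
rewrite functional_crease// [X in _ - X](_ : _ = 0).
  by rewrite subr0; nra.
by rewrite /trapezoid /simpson /affine /=; ring.
Qed.
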